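(* Let $n\geq 3$ and let $B_n$ be any polyomino chain with $n$ squares. Let $\Theta_1,\Theta_2,\Theta_3,\Theta_4$ be the constants $$\Theta_1=2\theta_{2,3}-6\theta_{3,3}+4\theta_{3,4},\quad \Theta_2=\theta_{2,4}-\theta_{2,3}+\theta_{3,3}-\theta_{3,4},$$ $$\Theta_3=2\theta_{2,4}-2\theta_{2,3}+3\theta_{3,3}-4\theta_{3,4}+\theta_{4,4},\quad \Theta_4=\theta_{3,3}-2\theta_{3,4}+\theta_{4,4}.$$ (1) If $\Theta_1>0$ and $\Theta_1+2\Theta_i>0$ for $i=2,3,4$, then $TI(B_n)$ is minimum (among all polyomino chains with $n$ squares) if and only if $B_n\cong L_n$. (2) If $\Theta_1<0$ and $\Theta_1+2\Theta_i<0$ for $i=2,3,4$, then $TI(B_n)$ is maximum (among all polyomino chains with $n$ squares) if and only if $B_n\cong L_n$.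
   Context: A polyomino system is a finite 2-connected plane graph in which each interior face is a regular (unit) square of side length one. Two squares are adjacent if they share an edge. A polyomino chain is a polyomino system in which every square is adjacent to at most two squares; its squares form a sequence $C_1,\dots,C_n$ in which exactly consecutive squares are adjacent. A square adjacent to only one other square is terminal; a square adjacent to two other squares is non-terminal. A kink is a non-terminal square having a vertex of degree 2 (degrees are taken in the graph of the chain). The linear chain $L_n$ is the polyomino chain with $n$ squares without kinks. Bond incident degree (BID) index: given a symmetric non-negative real valued function $f$, with $\theta_{a,b}=f(a,b)$, put $TI(G)=\sum_{uv\in E(G)}f(d_u,d_v)=\sum_{1\le a\le b\le\Delta(G)}x_{a,b}(G)\,\theta_{a,b}$, where $d_u$ is the degree of the vertex $u$, $\Delta(G)$ is the maximum degree, and $x_{a,b}(G)$ is the number of edges of $G$ connecting a vertex of degree $a$ with a vertex of degree $b$. *)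

(* Defs.v *)
From HB Require Import structures.
From mathcomp Require Import all_boot all_order all_algebra finmap.
From mathcomp Require Import boolp classical_sets functions cardinality reals.
Set Implicit Arguments.
Unset Strict Implicit.
Unset Printing Implicit Defensive.
Import Order.TTheory GRing.Theory Num.Theory.
Local Open Scope classical_set_scope.
Local Open Scope card_scope.
Local Open Scope ring_scope.

(* A 2-connected plane graph all of whose interior faces are unit squares is, *)
(* up to an isometry of the plane, drawn on the grid Z x Z.  A plane graph is *)
(* therefore given by a finite set of unit edges of that grid.                *)
Definition vertex : choiceType := (int * int)%type.

(* (v, false) is the edge from v to v + (1, 0), (v, true) the edge from v to  *)
(* v + (0, 1); each grid edge is represented exactly once.                    *)
Definition edge : choiceType := (vertex * bool)%type.

Definition src (e : edge) : vertex := e.1.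
Definition tgt (e : edge) : vertex :=
  if e.2 then (e.1.1, e.1.2 + 1) else (e.1.1 + 1, e.1.2).

Definition plane_graph := {fset edge}.

Definition verts (G : plane_graph) : {fset vertex} :=
  ([fset src e | e in G] `|` [fset tgt e | e in G])%fset.

Definition adj (G : plane_graph) : rel vertex := fun u v =>
  has (fun e => ((src e == u) && (tgt e == v)) || ((src e == v) && (tgt e == u)))
      (G : seq edge).

Definition deg (G : plane_graph) (v : vertex) : nat :=
  #|` [fset e in G | (src e == v) || (tgt e == v)]%fset|.

Definition connected_on (G : plane_graph) (A : {fset vertex}) : Prop :=
  forall u v, u \in A -> v \in A ->
  exists p : seq vertex, [/\ path (adj G) u p, last u p = v & {subset p <= A}].

Definition two_connected (G : plane_graph) : Prop :=
  [/\ (2 < #|` verts G|)%N, connected_on G (verts G)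
    & forall x, x \in verts G -> connected_on G (verts G `\ x)%fset].

(* The grid square [x, x + 1] x [y, y + 1], named by its corner (x, y).       *)
Definition cell : choiceType := (int * int)%type.

Definition sides (c : cell) : seq edge :=
  [:: (c, false); ((c.1, c.2 + 1), false); (c, true); ((c.1 + 1, c.2), true)].

Definition corners (c : cell) : seq vertex :=
  [:: c; (c.1 + 1, c.2); (c.1, c.2 + 1); (c.1 + 1, c.2 + 1)].

(* The faces of G, i.e. the connected components of the plane minus the       *)
(* drawing of G, are described by the cells they contain: two cells lie in    *)
(* the same face iff one can go from one to the other across grid edges that  *)
(* are not in G.  A face is interior, i.e. bounded, iff it has finitely many  *)
(* cells.                                                                     *)
Definition cross (G : plane_graph) : rel cell := fun c d =>
  (c != d) && has (fun e => (e \in sides d) && (e \notin G)) (sides c).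

Definition face (G : plane_graph) (c : cell) : set cell :=
  [set d | exists2 p : seq cell, path (cross G) c p & last c p = d].

Definition polyomino_system (G : plane_graph) : Prop :=
  two_connected G /\ forall c, finite_set (face G c) -> face G c = [set c].

Definition squares (G : plane_graph) : set cell :=
  [set c | finite_set (face G c)].

Definition share_edge (c d : cell) : bool :=
  (c != d) && has [in sides d] (sides c).

Definition adj_squares (G : plane_graph) (c : cell) : set cell :=
  [set d | squares G d /\ share_edge c d].

(* The squares form an open sequence: this excludes the 2 x 2 block.          *)
Definition polyomino_chain (n : nat) (G : plane_graph) : Prop :=
  [/\ polyomino_system G,
      forall c, squares G c -> adj_squares G c #<= `I_2
    & exists C : n.-tuple cell,
      [/\ uniq C, [set` C] = squares G
        & forall i j : 'I_n,
          share_edge (tnth C i) (tnth C j) = (j == i.+1 :> nat) || (i == j.+1 :> nat)]].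

Definition terminal (G : plane_graph) (c : cell) : Prop :=
  squares G c /\ adj_squares G c #= `I_1.

Definition nonterminal (G : plane_graph) (c : cell) : Prop :=
  squares G c /\ adj_squares G c #= `I_2.

Definition kink (G : plane_graph) (c : cell) : Prop :=
  nonterminal G c /\ exists2 v, v \in corners c & deg G v = 2%N.

Definition linear_chain (n : nat) (G : plane_graph) : Prop :=
  polyomino_chain n G /\ forall c, ~ kink G c.

Definition isomorphic (G H : plane_graph) : Prop :=
  exists2 phi : verts G -> verts H, bijective phi
    & forall u v : verts G, adj H (val (phi u)) (val (phi v)) = adj G (val u) (val v).

Section BondIncidentDegree.
Variables (R : realType) (f : nat -> nat -> R).

Definition TI (G : plane_graph) : R :=
  \sum_(e <- G) f (deg G (src e)) (deg G (tgt e)).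

Definition Theta1 : R := 2 * f 2 3 - 6 * f 3 3 + 4 * f 3 4.
Definition Theta2 : R := f 2 4 - f 2 3 + f 3 3 - f 3 4.
Definition Theta3 : R := 2 * f 2 4 - 2 * f 2 3 + 3 * f 3 3 - 4 * f 3 4 + f 4 4.
Definition Theta4 : R := f 3 3 - 2 * f 3 4 + f 4 4.

Definition TI_minimum (n : nat) (B : plane_graph) : Prop :=
  forall G, polyomino_chain n G -> TI B <= TI G.

Definition TI_maximum (n : nat) (B : plane_graph) : Prop :=
  forall G, polyomino_chain n G -> TI G <= TI B.
End BondIncidentDegree.

(* Main.v *)
Require Import Defs.
From mathcomp Require Import all_boot all_order all_algebra finmap.
From mathcomp Require Import boolp classical_sets functions cardinality reals.
From mathcomp Require Import zify ring lra.
Import Order.TTheory GRing.Theory Num.Theory.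
Local Open Scope ring_scope.

(** The index of a chain is the index of the straight chain of the same length plus
    a sum of local charges, each of which is zero or, under the hypotheses of the
    minimum case, positive; charges appear exactly next to the kinks.

    Locality is the geometric part. If two edges of a 2-connected plane graph meet
    at a vertex v, a path joining their other ends outside v closes them up to a walk
    that uses no other edge at v, and the cells encircled by this walk an odd
    number of times form a bounded set that no face leaves ([separation]). Bounded
    faces are single squares, and four squares around v would close up the chain, so
    the sectors around v are squares of the chain, all but one. Consequently every
    edge is a side of a square ([edge_in_square]), the degree of v is one more than the number of squares at v ([deg_count]), and
    squares with a common vertex are at most two apart in the chain
    ([share_corner_near]). So the degrees at the ends of the four sides of a square
    depend only on five consecutive squares, that is, up to translation, on a word
    of at most four unit steps. A computation over these words ([windows_fit])
    finds few local shapes, determined almost entirely by which of the square and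
    its neighbours are turns, i.e. kinks ([profile_fits]).

    Sharing the weight of an edge among the squares that it bounds turns the index
    into a sum over squares ([TI_weight]). Subtract the weights of the straight chain
    and let every turn give a fixed amount to both of its neighbours; these gifts
    cancel in the total ([TI_charge]). A square without turning neighbours is left with
    nothing. The others keep Theta1 / 2, Theta1, Theta1 / 2 + Theta2,
    (Theta1 + Theta3) / 2, Theta1 + Theta3 or Theta1 + Theta4, which are positive
    combinations of Theta1 and the sums Theta1 + 2 Theta_i ([charge_gt0]). So the index
    is minimum exactly for the chains without turns.

    Such a chain is a straight strip, and any two strips of the same length are
    related by a symmetry of the grid ([no_turn_grid_iso]). Conversely a turn creates a
    vertex of degree 4, and a straight chain has none, so a chain isomorphic to
    the linear one has no turn ([isomorphic_no_turn]). The maximum case is the minimum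
    case for - f. *)

(** * Parity of a closed walk around a cell *)

Definition joins (e : edge) (u w : vertex) : bool :=
  ((src e == u) && (tgt e == w)) || ((src e == w) && (tgt e == u)).

(** Whether a unit step crosses the ray going left from the centre of [c].
    Counting these crossings modulo 2 along a closed walk tells on which side of
    the walk the cell lies. *)
Definition left_cross (c : cell) (u w : vertex) : bool :=
  (u.1 <= c.1) && ((u.2 <= c.2) (+) (w.2 <= c.2)).

(** An edge [e] separates the cell named by its source from this one. *)
Definition other_cell (e : edge) : cell :=
  if e.2 then (e.1.1 - 1, e.1.2) else (e.1.1, e.1.2 - 1).

Fixpoint parity (h : vertex -> vertex -> bool) (x : vertex) (p : seq vertex) :=
  if p is y :: p' then h x y (+) parity h y p' else false.

Lemma pair_eqE (u w : int * int) : (u == w) = (u.1 == w.1) && (u.2 == w.2).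
Proof. by []. Qed.

Lemma joinsE (e : edge) (u w : vertex) : joins e u w =
  let t : int * int := (if e.2 then e.1.1 else e.1.1 + 1, if e.2 then e.1.2 + 1 else e.1.2) in
  [&& e.1.1 == u.1, e.1.2 == u.2, t.1 == w.1 & t.2 == w.2] ||
  [&& e.1.1 == w.1, e.1.2 == w.2, t.1 == u.1 & t.2 == u.2].
Proof. by rewrite /joins !pair_eqE /src /tgt; case: e => [[x y] []] /=; rewrite -!andbA. Qed.

Lemma left_cross_vert (e g : edge) (u w : vertex) : joins g u w -> e.2 ->
  left_cross e.1 u w (+) left_cross (other_cell e) u w = joins e u w.
Proof.
rewrite !joinsE /left_cross /other_cell => + e2; rewrite e2 /=.
by case: g.2; lia.
Qed.

(** The rays above and below a horizontal edge enclose the half-line of grid points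
    that ends at its source. A step crosses one of them when it enters or leaves the
    half-line, except along the edge itself. The number of entries and exits is even
    on a closed walk. *)
Lemma left_cross_horiz (e g : edge) (u w : vertex) : joins g u w -> ~~ e.2 ->
  left_cross e.1 u w (+) left_cross (other_cell e) u w =
  joins e u w (+) (((u.2 == e.1.2) && (u.1 <= e.1.1)) (+)
                   ((w.2 == e.1.2) && (w.1 <= e.1.1))).
Proof.
rewrite !joinsE /left_cross /other_cell => + /negbTE e2; rewrite e2 /=.
by case: g.2 => /orP[] /and4P[] /eqP <- /eqP <- /eqP <- /eqP <- /=; lia.
Qed.

Section Walks.

Implicit Types (h : vertex -> vertex -> bool) (x : vertex) (p : seq vertex).

Lemma eq_parity (r : rel vertex) h h' x p :
  (forall u w, r u w -> h u w = h' u w) -> path r x p -> parity h x p = parity h' x p.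
Proof.
by move=> hh'; elim: p x => //= y p IH x /andP[rxy rp]; rewrite hh' // IH.
Qed.

Lemma parityD h h' x p :
  parity (fun u w => h u w (+) h' u w) x p = parity h x p (+) parity h' x p.
Proof. by elim: p x => //= y p IH x; rewrite IH addbACA. Qed.

Lemma parity0 x p : parity (fun _ _ => false) x p = false.
Proof. by elim: p x => //= y p IH x. Qed.

Lemma parity_cat h x p q :
  parity h x (p ++ q) = parity h x p (+) parity h (last x p) q.
Proof. by elim: p x => //= y p IH x; rewrite IH addbA. Qed.

Lemma parity_telescope (k : vertex -> bool) x p :
  parity (fun u w => k u (+) k w) x p = k x (+) k (last x p).
Proof.
elim: p x => [|y p IH] x /=; first by rewrite addbb.
by rewrite IH -addbA (addbA (k y)) addbb.
Qed.

(** Even-odd rule: [c] is encircled an odd number of times by the walk [x :: p]. *)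
Definition inside x p (c : cell) := parity (left_cross c) x p.

(** Crossing an edge changes sides exactly when the walk uses the edge an odd
    number of times. *)
Lemma inside_boundary (G : plane_graph) x p (e : edge) :
  path (adj G) x p -> last x p = x ->
  inside x p e.1 (+) inside x p (other_cell e) = parity (joins e) x p.
Proof.
move=> Gp closed; rewrite /inside -parityD.
case e2: e.2.
  by apply: (eq_parity _ _ _ _ _ _ Gp) => u w /hasP[g _ guw]; apply: left_cross_vert guw _.
pose k (u : vertex) := (u.2 == e.1.2) && (u.1 <= e.1.1).
rewrite (eq_parity _ _ (fun u w => joins e u w (+) (k u (+) k w)) _ _ _ Gp); last first.
  by move=> u w /hasP[g _ guw]; apply: left_cross_horiz guw _; rewrite e2.
by rewrite parityD parity_telescope closed addbb addbF.
Qed.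

(** Far to the left, above or below, the ray meets no step; far to the right it
    meets every step crossing the row, and a closed walk crosses a row evenly
    often. *)
Lemma inside_bounded x p : last x p = x ->
  exists N : nat, forall c, inside x p c ->
    [&& - N%:Z <= c.1, c.1 <= N%:Z, - N%:Z <= c.2 & c.2 <= N%:Z].
Proof.
move=> closed.
pose N := (\sum_(u <- x :: p) (`|u.1| + `|u.2|))%N.
have Nmax u : u \in x :: p -> (`|u.1| + `|u.2| <= N)%N.
  by move=> uxp; rewrite /N (big_rem u uxp) leq_addr.
exists N => c; apply: contraTT => out.
have eq_par h h1 : {in x :: p &, h =2 h1} -> parity h x p = parity h1 x p.
  move=> eqh; elim: p x {closed N Nmax out} eqh => //= y p IH x hF.
  rewrite hF ?inE ?eqxx ?orbT //=; congr (_ (+) _); apply: IH => u w uyp wyp.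
  by apply: hF; rewrite inE ?uyp ?wyp orbT.
have [c1N | c1N] := lerP c.1 N%:Z; last first.
  rewrite /inside (eq_par _ (fun u w => (u.2 <= c.2) (+) (w.2 <= c.2))); last first.
    move=> u w /Nmax uN _; rewrite /left_cross.
    by have -> : u.1 <= c.1 by lia.
  by rewrite (parity_telescope (fun u : vertex => u.2 <= c.2)) closed addbb.
rewrite /inside (eq_par _ (fun _ _ => false)) ?parity0 // => u w /Nmax uN /Nmax wN.
rewrite /left_cross; lia.
Qed.

End Walks.

(** * Closed walks separate the faces around a vertex *)

Lemma mem_sides (e : edge) (c : cell) : (e \in sides c) = (c == e.1) || (c == other_cell e).
Proof.
rewrite /sides !inE /other_cell; case: e c => [[x y] []] [a b] /=;
  rewrite !xpair_eqE /= ?andbT ?andbF ?orbF /=; lia.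
Qed.

Lemma sides_inj (c d : cell) (e : edge) : c != d -> e \in sides c -> e \in sides d ->
  (c = e.1 /\ d = other_cell e) \/ (c = other_cell e /\ d = e.1).
Proof.
rewrite !mem_sides => /negP cd /orP[] /eqP ce /orP[] /eqP de; subst; auto; by case: cd.
Qed.

Lemma other_cell_neq (e : edge) : other_cell e != e.1.
Proof. by rewrite /other_cell; case: e => [[x y] []] /=; rewrite xpair_eqE; lia. Qed.

Lemma joins_inj (e g : edge) (u w : vertex) : joins e u w -> joins g u w -> e = g.
Proof.
case: e g => [[x y] b] [[s t] k].
rewrite !joinsE; case: b; case: k => /= /orP[] /and4P[] /eqP <- /eqP <- /eqP <- /eqP <- H;
  do ?congr (_, _); lia.
Qed.

Lemma joins_sym (e : edge) (u w : vertex) : joins e u w = joins e w u.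
Proof. by rewrite /joins orbC. Qed.

Lemma finite_box (N : nat) : finite_set
  [set c : cell | [&& - N%:Z <= c.1, c.1 <= N%:Z, - N%:Z <= c.2 & c.2 <= N%:Z]].
Proof.
pose h (ij : 'I_(N + N).+1 * 'I_(N + N).+1) : cell :=
  ((ij.1 : nat)%:Z - N%:Z, (ij.2 : nat)%:Z - N%:Z).
apply: (@sub_finite_set _ _ (h @` [set: _])%classic); last first.
  by apply: finite_image; exact: finite_finset.
move=> [a b] /= /and4P[a1 a2 b1 b2].
have Ha : (absz (a + N%:Z)%R < (N + N).+1)%N by lia.
have Hb : (absz (b + N%:Z)%R < (N + N).+1)%N by lia.
exists (Ordinal Ha, Ordinal Hb) => //; rewrite /h /=; congr (_, _); lia.
Qed.

Lemma parity_joins_out (G : plane_graph) (x : vertex) (p : seq vertex) (e : edge) :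
  path (adj G) x p -> e \notin G -> parity (joins e) x p = false.
Proof.
move=> Gp eG; rewrite (eq_parity _ _ (fun _ _ => false) _ _ _ Gp) ?parity0 //.
move=> u w /hasP[g gG guw]; apply: contraNF eG => euw.
by rewrite (joins_inj _ _ _ _ euw guw).
Qed.

(** A face never crosses the walk, so the face of a cell inside is confined to the
    bounded inside. *)
Lemma inside_squares (G : plane_graph) (x : vertex) (p : seq vertex) (c : cell) :
  path (adj G) x p -> last x p = x -> inside x p c -> squares G c.
Proof.
move=> Gp closed cin; have [N Nin] := inside_bounded x p closed.
apply: sub_finite_set (finite_box N) => d [q cq <-]; apply: Nin.
elim: q c cin cq => //= b q IH c cin /andP[/andP[cb /hasP[e ec /andP[eb eG]]] bq].
apply: IH bq; move: (inside_boundary G x p e Gp closed).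
rewrite (parity_joins_out _ _ _ _ Gp eG).
by case: (sides_inj c b e cb ec eb) cin => -[-> ->] ->; case: (inside _ _ _).
Qed.

(** Otherwise the face of [c] would contain the cell behind the missing side. *)
Lemma squares_sides (G : plane_graph) (c : cell) (e : edge) :
  polyomino_system G -> squares G c -> e \in sides c -> e \in G.
Proof.
move=> [_ Gface] cG ec; apply/negPn/negP => eG.
have {Gface}Gc : face G c = [set c]%classic by apply: Gface.
pose d := if c == e.1 then other_cell e else e.1.
have dc : c != d.
  by rewrite /d; case: (eqVneq c e.1) => [->|//]; rewrite eq_sym other_cell_neq.
suff : face G c d by rewrite Gc => cd; rewrite -cd eqxx in dc.
exists [:: d] => //=; rewrite andbT /cross dc; apply/hasP; exists e => //.
by rewrite eG andbT mem_sides /d; case: ifP; rewrite eqxx ?orbT.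
Qed.

Definition incident (e : edge) (v : vertex) := (src e == v) || (tgt e == v).

Lemma incident_joins (e : edge) (v : vertex) : incident e v ->
  exists2 w, joins e v w & w != v.
Proof.
case/orP => /eqP <-; [exists (tgt e) | exists (src e)]; rewrite /joins ?eqxx ?orbT //;
 case: e => [[x y] []]; rewrite /src /tgt /= xpair_eqE; lia.
Qed.

Lemma joins_incident (e : edge) (u w : vertex) : joins e u w -> incident e u.
Proof. by rewrite /joins /incident => /orP[] /andP[a b]; rewrite ?a ?b ?orbT. Qed.

Lemma incident_verts (G : plane_graph) (e : edge) (v : vertex) :
  e \in G -> incident e v -> v \in verts G.
Proof.
move=> eG /orP[] /eqP <-; rewrite /verts inE; apply/orP; [left|right];
  by apply/imfsetP; exists e.
Qed.

Lemma joins_det (e : edge) (u w w1 : vertex) : joins e u w -> joins e u w1 -> w = w1.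
Proof.
case: e u w w1 => [[x y] b] [u1 u2] [w1 w2] [z1 z2]; rewrite !joinsE.
by case: b => /= /orP[] /and4P[] /eqP <- /eqP <- /eqP <- /eqP <- H; congr (_, _); lia.
Qed.

(** The form of the Jordan curve theorem on which the whole geometry rests.
    Deleting [v] leaves the other ends of [e1] and [e2] connected, hence there is
    a closed walk through [v] that uses exactly [e1] and [e2] among the edges at
    [v]; [inner] is its inside. *)
Lemma separation (G : plane_graph) (v : vertex) (e1 e2 : edge) :
  two_connected G -> e1 \in G -> e2 \in G -> e1 != e2 -> incident e1 v -> incident e2 v ->
  exists2 inner : cell -> bool, forall c, inner c -> squares G c
    & forall g, incident g v -> inner g.1 (+) inner (other_cell g) = (g == e1) (+) (g == e2).
Proof.
move=> [_ _ Gconn] e1G e2G e12 e1v e2v.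
have vG : v \in verts G by apply: incident_verts e1G e1v.
have [w1 j1 w1v] := incident_joins _ _ e1v; have [w2 j2 w2v] := incident_joins _ _ e2v.
have inGv e w : e \in G -> joins e v w -> w != v -> w \in (verts G `\ v)%fset.
  rewrite joins_sym => eG je wv; rewrite in_fsetD1 wv /=.
  by apply: incident_verts eG _; apply: joins_incident je.
have [p [Gp plast pv]] := Gconn v vG w1 w2 (inGv _ _ e1G j1 w1v) (inGv _ _ e2G j2 w2v).
have vp : v \notin p by apply/negP => /pv; rewrite !inE eqxx.
pose q := w1 :: rcons p v.
have closed : last v q = v by rewrite /q /= last_rcons.
have Gq : path (adj G) v q.
  rewrite /q /= rcons_path Gp plast; apply/and3P; split=> //.
    by apply/hasP; exists e1.
  by apply/hasP; exists e2 => //; rewrite -/(joins e2 w2 v) joins_sym.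
exists (inside v q) => [c|g gv]; first exact: inside_squares Gq closed.
rewrite (inside_boundary _ _ _ _ Gq closed) /q /= -cats1 parity_cat plast /= addbF.
have joinsv e w : joins e v w -> joins g v w = (g == e).
  move=> je; apply/idP/eqP => [jg|->//]; exact: joins_inj jg je.
rewrite (joinsv _ _ j1) joins_sym (joinsv _ _ j2).
congr (_ (+) _); rewrite -[RHS]addFb; congr (_ (+) _).
have {Gq closed q plast}: v \notin w1 :: p by rewrite inE negb_or eq_sym w1v.
have [z jz zv] := incident_joins _ _ gv.
elim: p w1 {pv vp Gp j1 w1v} => //= u p IH w1; rewrite !inE !negb_or => /and3P[vw1 vu vp].
rewrite IH ?inE ?negb_or ?vu // addbF; apply/negbTE/negP => jg.
have vu1 : v \in [:: w1; u].
  move: jz jg; rewrite /joins !inE => /orP[] /andP[/eqP -> /eqP ->] /orP[] /andP[a b];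
    by rewrite ?a ?b ?orbT.
by move: vu1; rewrite !inE (negbTE vw1) (negbTE vu).
Qed.

(** * Degrees and squares around a vertex of a chain *)

Definition star (v : vertex) : seq edge :=
  [:: (v, false); (v, true); ((v.1 - 1, v.2), false); ((v.1, v.2 - 1), true)].

(** The four cells around [v], counterclockwise, interleaved with the edges of
    [star v]: cell number k lies between edges number k and k + 1. *)
Definition around (v : vertex) : seq cell :=
  [:: v; (v.1 - 1, v.2); (v.1 - 1, v.2 - 1); (v.1, v.2 - 1)].

Lemma mem_star (e : edge) (v : vertex) : incident e v = (e \in star v).
Proof.
rewrite /star !inE /incident /src /tgt.
by case: e v => [[x y] []] [a b] /=; rewrite !xpair_eqE /= ?andbT ?andbF ?orbF; lia.
Qed.

Lemma mem_around (c : cell) (v : vertex) : (v \in corners c) = (c \in around v).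
Proof. by rewrite !inE; case: c v => [x y] [a b]; rewrite !xpair_eqE /=; lia. Qed.

Lemma uniq_star (v : vertex) : uniq (star v).
Proof. by case: v => a b; rewrite /= !inE !xpair_eqE /=; lia. Qed.

Lemma uniq_around (v : vertex) : uniq (around v).
Proof. by case: v => a b; rewrite /= !inE !xpair_eqE /=; lia. Qed.

Lemma deg_star (G : plane_graph) (v : vertex) : deg G v = count [in G] (star v).
Proof.
rewrite /deg -size_filter; apply/perm_size/uniq_perm; rewrite ?filter_uniq ?uniq_star //.
by move=> e; rewrite mem_filter -mem_star !inE.
Qed.

Lemma count_uniq_exchange (T : eqType) (s t : seq T) :
  uniq s -> uniq t -> count [in s] t = count [in t] s.
Proof.
move=> us ut; rewrite -!size_filter; apply/perm_size/uniq_perm; rewrite ?filter_uniq //.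
by move=> x; rewrite !mem_filter andbC.
Qed.

(** An end of a pendant edge would separate its other end from the rest. *)
Lemma second_edge (G : plane_graph) (v : vertex) (e : edge) : two_connected G ->
  e \in G -> incident e v -> exists g, [/\ g \in G, incident g v & g != e].
Proof.
move=> [G3 _ Gconn] eG ev; have [w jw wv] := incident_joins _ _ ev.
have vG : v \in verts G := incident_verts _ _ _ eG ev.
have wG : w \in verts G.
  by apply: incident_verts eG _; apply: (joins_incident _ _ v); rewrite joins_sym.
have [x xG /andP[xv xw]] : exists2 x, x \in verts G & (x != v) && (x != w).
  apply: contrapT => none; move: G3; rewrite ltnNge => /negP; apply.
  rewrite -(_ : #|` [fset v; w]%fset| = 2%N); last by rewrite cardfs2 eq_sym wv.
  apply: fsubset_leq_card; apply/fsubsetP => x xG; rewrite !inE.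
  by apply: contrapT => /negP; rewrite negb_or => xvw; apply: none; exists x.
have [|| p [Gp plast pw]] := Gconn w wG v x; rewrite ?in_fsetD1 ?xw 1?eq_sym ?wv //.
case: p Gp plast pw => [_ /= vx|u p /= /andP[/hasP[g gG gvu] _] _ pw].
  by rewrite vx eqxx in xv.
exists g; split=> //; first exact: joins_incident gvu.
apply/eqP => ge; have uw := joins_det _ _ _ _ jw; rewrite -ge in uw.
by have := pw u (mem_head _ _); rewrite -(uw _ gvu) in_fsetD1 eqxx.
Qed.

(** [E], [N], [W], [S] say which edges are present at a vertex, [ne], [nw], [sw],
    [se] which cells around it are squares. Of the two arcs cut out by two present
    edges, one consists of squares; so every sector but one is a single square, and
    the missing one is there because four squares would form a block. *)
Lemma sector_count (E N W S ne nw sw se : bool) :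
  [|| E, N, W | S] -> ~~ [&& ne, nw, sw & se] ->
  [&& E ==> [|| N, W | S], N ==> [|| E, W | S], W ==> [|| E, N | S] & S ==> [|| E, N | W]] ->
  [&& ne ==> E && N, nw ==> N && W, sw ==> W && S & se ==> S && E] ->
  [&& E && N ==> ne || [&& nw, sw & se], E && W ==> ne && nw || sw && se &
      E && S ==> [&& ne, nw & sw] || se] ->
  [&& N && W ==> nw || [&& ne, sw & se], N && S ==> nw && sw || ne && se &
      W && S ==> sw || [&& ne, nw & se]] ->
  (E + (N + (W + (S + 0))) = (ne + (nw + (sw + (se + 0)))).+1)%N /\
  (ne -> sw -> nw || se) /\ (nw -> se -> ne || sw).
Proof.
by case: E; case: N; case: W; case: S; case: ne; case: nw; case: sw; case: se.
Qed.

Lemma uniq4 (T : eqType) (a b c d : T) : uniq [:: a; b; c; d] ->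
  (a != b) * (a != c) * (a != d) * (b != c) * (b != d) * (c != d).
Proof.
by rewrite /= !inE !negb_or => /and4P[/and3P[-> -> ->] /andP[-> ->] -> _].
Qed.

Lemma share_edge_sym (c d : cell) : share_edge c d = share_edge d c.
Proof.
rewrite /share_edge eq_sym; congr (_ && _).
by apply/hasP/hasP => -[e e1 e2]; exists e.
Qed.

Section Chain.

Variables (n : nat) (G : plane_graph) (C : n.-tuple cell).
Hypothesis Gsys : polyomino_system G.
Hypothesis uniqC : uniq C.
Hypothesis CG : forall c, reflect (squares G c) (c \in C).
Hypothesis C_adj : forall i j : 'I_n,
  share_edge (tnth C i) (tnth C j) = (j == i.+1 :> nat) || (i == j.+1 :> nat).

Lemma chain_sides (c : cell) (e : edge) : c \in C -> e \in sides c -> e \in G.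
Proof. by move=> /CG; apply: squares_sides. Qed.

Lemma share_edgeP (c d : cell) (e : edge) :
  c != d -> e \in sides c -> e \in sides d -> share_edge c d.
Proof. by move=> cd ec ed; rewrite /share_edge cd; apply/hasP; exists e. Qed.

(** Indices along the chain would have to go around a 4-cycle of steps by one. *)
Lemma no_block (c0 c1 c2 c3 : cell) : c0 != c2 -> c1 != c3 ->
  share_edge c0 c1 -> share_edge c1 c2 -> share_edge c2 c3 -> share_edge c3 c0 ->
  ~~ [&& c0 \in C, c1 \in C, c2 \in C & c3 \in C].
Proof.
move=> c02 c13 s01 s12 s23 s30.
apply/negP => /and4P[/tnthP[i0 e0] /tnthP[i1 e1] /tnthP[i2 e2] /tnthP[i3 e3]].
have i02 : i0 != i2 by apply: contraNneq c02; rewrite e0 e2 => ->.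
have i13 : i1 != i3 by apply: contraNneq c13; rewrite e1 e3 => ->.
move: s01 s12 s23 s30; rewrite e0 e1 e2 e3 !C_adj => + + + +.
rewrite -!val_eqE /= in i02 i13; lia.
Qed.

Lemma around_sides (v : vertex) :
  [/\ share_edge v (v.1 - 1, v.2), share_edge (v.1 - 1, v.2) (v.1 - 1, v.2 - 1),
      share_edge (v.1 - 1, v.2 - 1) (v.1, v.2 - 1) & share_edge (v.1, v.2 - 1) v].
Proof.
case: v => x y; split.
- apply: (share_edgeP _ _ ((x, y), true)); rewrite ?mem_sides /other_cell /= !xpair_eqE; lia.
- apply: (share_edgeP _ _ ((x - 1, y), false)); rewrite ?mem_sides /other_cell /= !xpair_eqE; lia.
- apply: (share_edgeP _ _ ((x, y - 1), true)); rewrite ?mem_sides /other_cell /= !xpair_eqE; lia.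
- apply: (share_edgeP _ _ ((x, y), false)); rewrite ?mem_sides /other_cell /= !xpair_eqE; lia.
Qed.

(** The edge and a second one at its source bound a closed walk that has exactly
    one of the two cells of the edge inside. *)
Lemma edge_in_square (e : edge) : e \in G -> (e.1 \in C) || (other_cell e \in C).
Proof.
move=> eG; have es : incident e (src e) by rewrite /incident eqxx.
have [g [gG gs ge]] := second_edge _ _ _ Gsys.1 eG es.
have eg : e != g by rewrite eq_sym.
have [inner inner_sq inner_sep] := separation _ _ _ _ Gsys.1 eG gG eg es gs.
have := inner_sep e es; rewrite eqxx (negbTE eg).
case Ie: (inner e.1); first by move/inner_sq/CG: Ie => ->.
by case Io: (inner _) => // _; move/inner_sq/CG: Io => ->; rewrite orbT.
Qed.

Lemma vertex_sectors (v : vertex) : v \in verts G ->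
  deg G v = (count [in C] (around v)).+1 /\
  (v \in C -> (v.1 - 1, v.2 - 1) \in C -> ((v.1 - 1, v.2) \in C) || ((v.1, v.2 - 1) \in C)) /\
  ((v.1 - 1, v.2) \in C -> (v.1, v.2 - 1) \in C -> (v \in C) || ((v.1 - 1, v.2 - 1) \in C)).
Proof.
move=> vG; rewrite deg_star /=.
pose E : edge := (v, false); pose N : edge := (v, true).
pose W : edge := ((v.1 - 1, v.2), false); pose S : edge := ((v.1, v.2 - 1), true).
pose NE : cell := v; pose NW : cell := (v.1 - 1, v.2).
pose SW : cell := (v.1 - 1, v.2 - 1); pose SE : cell := (v.1, v.2 - 1).
rewrite -/E -/N -/W -/S -/NW -/SW -/SE -/NE.
have vE : incident E v by rewrite mem_star !inE eqxx ?orbT.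
have vN : incident N v by rewrite mem_star !inE eqxx ?orbT.
have vW : incident W v by rewrite mem_star !inE eqxx ?orbT.
have vS : incident S v by rewrite mem_star !inE eqxx ?orbT.
have sep e1 e2 : incident e1 v -> incident e2 v -> e1 != e2 -> e1 \in G -> e2 \in G ->
  exists a b c d : bool, [/\ [&& a ==> (NE \in C), b ==> (NW \in C), c ==> (SW \in C)
     & d ==> (SE \in C)], a (+) d = (E == e1) (+) (E == e2), a (+) b = (N == e1) (+) (N == e2),
     b (+) c = (W == e1) (+) (W == e2) & d (+) c = (S == e1) (+) (S == e2)].
  move=> e1v e2v e12 e1G e2G.
  have [inner inner_sq inner_sep] := separation _ _ _ _ Gsys.1 e1G e2G e12 e1v e2v.
  exists (inner NE), (inner NW), (inner SW), (inner SE); split; rewrite -?inner_sep //.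
  by apply/and4P; split; apply/implyP => /inner_sq/CG.
have [[[[[EN EW] ES] NW_] NS] WS] := uniq4 _ _ _ _ _ (uniq_star v).
rewrite -/E -/N -/W -/S in EN EW ES NW_ NS WS.
have neE := (eq_sym N E, eq_sym W E, eq_sym S E, eq_sym W N, eq_sym S N, eq_sym S W,
  negbTE EN, negbTE EW, negbTE ES, negbTE NW_, negbTE NS, negbTE WS, eqxx).
have [[[[[_ c02] _] _] c13] _] := uniq4 _ _ _ _ _ (uniq_around v).
have [s1 s2 s3 s4] := around_sides v.
apply: sector_count.
- move: vG; rewrite /verts inE => /orP[] /imfsetP[e /= eG ve];
  have : incident e v by rewrite /incident ve eqxx ?orbT.
    by rewrite mem_star !inE => /or4P[] /eqP ee; rewrite ee in eG; rewrite eG ?orbT.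
  by rewrite mem_star !inE => /or4P[] /eqP ee; rewrite ee in eG; rewrite eG ?orbT.
- exact: no_block c02 c13 s1 s2 s3 s4.
- apply/and4P; split; apply/implyP => eG; have [//|g [gG +]] := second_edge _ v _ Gsys.1 eG;
    rewrite mem_star !inE => /or4P[] /eqP ge; rewrite -?/E -?/N -?/W -?/S in ge;
    by rewrite ge in gG *; rewrite ?eqxx // gG ?orbT.
- apply/and4P; split; apply/implyP => sq; rewrite !(chain_sides _ _ sq) // mem_sides;
    by rewrite /other_cell ?eqxx ?orbT.
- apply/and3P; split; apply/implyP => /andP[e1 e2];
    [have [] := sep _ _ vE vN EN e1 e2 |
     have [] := sep _ _ vE vW EW e1 e2 |
     have [] := sep _ _ vE vS ES e1 e2];
    rewrite !neE /= => -[] [] [] [] [] [] [] [] // [/and4P[]];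
    by case: (NE \in C); case: (NW \in C); case: (SW \in C); case: (SE \in C).
- apply/and3P; split; apply/implyP => /andP[e1 e2];
    [have [] := sep _ _ vN vW NW_ e1 e2 |
     have [] := sep _ _ vN vS NS e1 e2 |
     have [] := sep _ _ vW vS WS e1 e2];
    rewrite !neE /= => -[] [] [] [] [] [] [] [] // [/and4P[]];
    by case: (NE \in C); case: (NW \in C); case: (SW \in C); case: (SE \in C).
Qed.

Lemma deg_count (v : vertex) : v \in verts G ->
  deg G v = (count (fun c => v \in corners c) C).+1.
Proof.
move=> /vertex_sectors[-> _]; rewrite (count_uniq_exchange _ _ _ uniqC (uniq_around v)).
by congr _.+1; apply: eq_count => c; rewrite /= mem_around.
Qed.

Lemma corner_verts (c : cell) (v : vertex) : c \in C -> v \in corners c -> v \in verts G.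
Proof.
move=> cC; have sG := chain_sides c _ cC; case: c sG {cC} => x y sG.
rewrite !in_cons in_nil orbF => /or4P[] /eqP ->.
- by apply: (incident_verts _ ((x, y), false) _); rewrite ?sG ?inE ?eqxx // mem_star !inE eqxx.
- apply: (incident_verts _ ((x, y), false) _); rewrite ?sG ?inE ?eqxx //.
  by rewrite /incident /tgt eqxx orbT.
- apply: (incident_verts _ ((x, y), true) _); rewrite ?sG ?inE ?eqxx ?orbT //.
  by rewrite /incident /tgt eqxx orbT.
- apply: (incident_verts _ ((x + 1, y), true) _); rewrite ?sG ?inE ?eqxx ?orbT //.
  by rewrite /incident /tgt eqxx orbT.
Qed.

(** Two squares meeting only at a vertex have a common neighbour there, since
    the squares around a vertex form one contiguous arc. *)
Lemma share_corner_near (i j : 'I_n) (v : vertex) :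
  v \in corners (tnth C i) -> v \in corners (tnth C j) -> (i <= j + 2)%N.
Proof.
move=> vi vj; have [_ [diag anti]] := vertex_sectors v (corner_verts _ _ (mem_tnth i C) vi).
have [s1 s2 s3 s4] := around_sides v.
have step (a b : 'I_n) : share_edge (tnth C a) (tnth C b) -> (a <= b + 1)%N && (b <= a + 1)%N.
  rewrite C_adj; lia.
have via c : c \in C -> share_edge (tnth C i) c -> share_edge c (tnth C j) -> (i <= j + 2)%N.
  move=> /tnthP[k ->] /step ik /step kj; lia.
have via1 : share_edge (tnth C i) (tnth C j) -> (i <= j + 2)%N by move/step; lia.
have via0 : tnth C i = tnth C j -> (i <= j + 2)%N.
  by move/(tuple_uniqP _ uniqC) => ->; rewrite leq_addr.
have Ci := mem_tnth i C; have Cj := mem_tnth j C.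
move: vi vj via via1 via0 Ci Cj; rewrite !mem_around !inE.
by move=> /or4P[] /eqP -> /or4P[] /eqP -> via via1 via0 Ci Cj; first
  [exact: via0 | apply: via1; by rewrite // share_edge_sym
  | have [] := orP (diag Ci Cj) | have [] := orP (diag Cj Ci)
  | have [] := orP (anti Ci Cj) | have [] := orP (anti Cj Ci)];
  move=> /via; apply; by rewrite // share_edge_sym.
Qed.

End Chain.

(** * The local shape of a chain *)

Definition origin : cell := (0, 0).

Definition shift (t c : int * int) : int * int := (t.1 + c.1, t.2 + c.2).

Definition shift_edge (t : int * int) (e : edge) : edge := (shift t e.1, e.2).

(** The triple (m, (a, b)) stands for a side that bounds m squares and whose ends
    have degrees a <= b. *)
Definition side_type : eqType := (nat * (nat * nat))%type.

(** Degrees are read off from the squares, by the count of squares at a vertex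
    plus one, so that the profile can be computed from a list of cells alone. *)
Definition profile (C : seq cell) (c : cell) : seq side_type :=
  [seq let a := (count (fun d => src e \in corners d) C).+1 in
       let b := (count (fun d => tgt e \in corners d) C).+1 in
       (count (fun d => e \in sides d) C, (minn a b, maxn a b)) | e <- sides c].

Definition collinear (a b c : cell) : bool :=
  (a.1 + c.1 == b.1 + b.1) && (a.2 + c.2 == b.2 + b.2).

(** The index of a kink, recognised from the positions of the squares. *)
Definition turn (s : seq cell) (j : nat) : bool :=
  [&& 0 < j, j.+1 < size s
    & ~~ collinear (nth origin s j.-1) (nth origin s j) (nth origin s j.+1)]%N.

(** Induced paths for [share_edge], in a form that computes and passes to contiguous
    sublists. *)
Fixpoint snake (s : seq cell) : bool :=
  if s is x :: s1 then
    [&& x \notin s1, if s1 is y :: s2 then share_edge x y && ~~ has (share_edge x) s2 else true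
      & snake s1]
  else true.

(** The possible profiles of a square, according to whether it is terminal ([t]),
    whether it is a turn ([k]) and whether its predecessor ([l]) and its successor
    ([r]) are. A straight square between two turns has two possible profiles: its
    turns bend to the same side, and two vertices of degree 4 are then joined by an
    edge, or to opposite sides. *)
Definition profiles (t k l r : bool) : seq (seq side_type) :=
  let x m a b : side_type := (m, (a, b)) in
  match t, k, (l + r)%N with
  | false, false, 0 => [:: [:: x 2 3 3; x 2 3 3; x 1 3 3; x 1 3 3]]
  | false, false, 1 => [:: [:: x 2 3 4; x 2 3 3; x 1 3 4; x 1 3 3]]
  | false, false, _ => [:: [:: x 2 3 4; x 2 3 4; x 1 4 4; x 1 3 3];
                           [:: x 2 3 4; x 2 3 4; x 1 3 4; x 1 3 4]]
  | false, true, 0 => [:: [:: x 2 3 4; x 2 3 4; x 1 2 3; x 1 2 3]]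
  | false, true, 1 => [:: [:: x 2 4 4; x 2 3 4; x 1 2 4; x 1 2 3]]
  | false, true, _ => [:: [:: x 2 4 4; x 2 4 4; x 1 2 4; x 1 2 4]]
  | true, false, 0 => [:: [:: x 2 3 3; x 1 2 2; x 1 2 3; x 1 2 3]]
  | true, false, 1 => [:: [:: x 2 3 4; x 1 2 2; x 1 2 3; x 1 2 4]]
  | _, _, _ => [::]
  end%N.

Definition fits (s : seq cell) (i : nat) (p : seq side_type) : bool :=
  has (perm_eq p)
    (profiles ((i == 0) || (i.+1 == size s))%N (turn s i) (turn s i.-1) (turn s i.+1)).

Definition dirs : seq (int * int) := [:: (1, 0); (0, 1); (-1, 0); (0, -1)].

Fixpoint words (k : nat) : seq (seq (int * int)) :=
  if k is k1.+1 then [seq d :: w | d <- dirs, w <- words k1] else [:: [::]].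

Definition walk (x : cell) (w : seq (int * int)) : seq cell := x :: scanl shift x w.

Definition fits_window (m : nat) (s : seq cell) : bool :=
  snake s ==> fits s m (profile s (nth origin s m)).

(** A chain is, up to translation, a walk with unit steps; all walks of two to four
    steps are inspected, with the observed square at position 0, 1 or 2. *)
Lemma windows_fit :
  [&& all (fun w => [&& fits_window 0 (walk origin w), fits_window 1 (walk origin w)
                      & fits_window 2 (walk origin w)]) (words 2),
      all (fun w => fits_window 1 (walk origin w) && fits_window 2 (walk origin w)) (words 3)
    & all (fun w => fits_window 2 (walk origin w)) (words 4)].
Proof. by vm_compute. Qed.

Lemma shift_inj (t : int * int) : injective (shift t).
Proof. by move=> [a b] [c d] [] /addrI -> /addrI ->. Qed.

Lemma shift_edge_inj (t : int * int) : injective (shift_edge t).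
Proof. by move=> [c b] [d k] [] /addrI c1 /addrI c2 ->; case: c d c1 c2 => ? ? [? ?] /= -> ->. Qed.

Lemma corners_shift (t c : int * int) : corners (shift t c) = map (shift t) (corners c).
Proof. by rewrite /corners /shift /= !addrA. Qed.

Lemma sides_shift (t c : int * int) : sides (shift t c) = map (shift_edge t) (sides c).
Proof. by rewrite /sides /shift_edge /shift /= !addrA. Qed.

Lemma src_shift (t : int * int) (e : edge) : src (shift_edge t e) = shift t (src e).
Proof. by []. Qed.

Lemma tgt_shift (t : int * int) (e : edge) : tgt (shift_edge t e) = shift t (tgt e).
Proof. by case: e => [[x y] []]; rewrite /tgt /shift /= addrA. Qed.

Lemma profile_shift (t : int * int) (s : seq cell) (c : cell) :
  profile (map (shift t) s) (shift t c) = profile s c.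
Proof.
rewrite /profile sides_shift -map_comp; apply: eq_map => e; rewrite /comp.
rewrite tgt_shift src_shift !count_map.
have cornersE v : (fun d => shift t v \in corners (shift t d)) =1 (fun d => v \in corners d).
  by move=> d; rewrite corners_shift mem_map //; apply: shift_inj.
rewrite (eq_count (cornersE (src e))) (eq_count (cornersE (tgt e))).
congr (_, _); apply: eq_count => d /=.
by rewrite sides_shift mem_map //; apply: shift_edge_inj.
Qed.

Lemma share_edge_shift (t c d : int * int) : share_edge (shift t c) (shift t d) = share_edge c d.
Proof.
rewrite /share_edge (inj_eq (shift_inj t)) !sides_shift has_map; congr (_ && _).
by apply: eq_has => e; apply: (mem_map (@shift_edge_inj t)).
Qed.

Lemma snake_shift (t : int * int) (s : seq cell) : snake (map (shift t) s) = snake s.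
Proof.
elim: s => //= x s ->; rewrite mem_map; last exact: shift_inj.
case: s => //= y s; rewrite share_edge_shift has_map; congr [&& _, _ && ~~ _ & _].
by apply: eq_has => z /=; rewrite share_edge_shift.
Qed.

Lemma collinear_shift (t a b c : int * int) :
  collinear (shift t a) (shift t b) (shift t c) = collinear a b c.
Proof. rewrite /collinear /shift /=; lia. Qed.

Lemma turn_shift (t : int * int) (s : seq cell) (j : nat) :
  turn (map (shift t) s) j = turn s j.
Proof.
rewrite /turn size_map; case: (ltnP 0 j) => //= j0; case: (ltnP j.+1 (size s)) => //= js.
have js1 := ltnW js; have js2 := leq_ltn_trans (leq_pred j) js1.
by rewrite !(nth_map origin) ?collinear_shift.
Qed.

Lemma share_edge_step (c d : cell) : share_edge c d -> (d.1 - c.1, d.2 - c.2) \in dirs.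
Proof.
move=> /andP[cd /hasP[e ec ed]].
by have [[-> ->]|[-> ->]] := sides_inj c d e cd ec ed; case: e {cd ec ed} => [[x y] []];
  rewrite /other_cell /dirs !inE !xpair_eqE /=; lia.
Qed.

Lemma mem_words (w : seq (int * int)) : all [in dirs] w -> w \in words (size w).
Proof.
elim: w => //= d w IH /andP[dd dw].
by apply: (allpairs_f cons dd); apply: IH.
Qed.

Lemma scanl_shift (x y : cell) (w : seq (int * int)) :
  scanl shift (shift x y) w = map (shift x) (scanl shift y w).
Proof.
have shiftA a b : shift (shift x a) b = shift x (shift a b) by rewrite /shift /= -!addrA.
by elim: w y => //= d w IH y; rewrite -IH shiftA.
Qed.

Lemma snake_walk (x : cell) (s : seq cell) : snake (x :: s) ->
  exists2 w, all [in dirs] w & x :: s = map (shift x) (walk origin w).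
Proof.
have shift0 z : shift z origin = z by case: z => a b; rewrite /shift /= !addr0.
suff H : snake (x :: s) -> exists2 w, all [in dirs] w & s = scanl shift x w.
  by move=> /H[w dw ->]; exists w => //; rewrite /walk /= -scanl_shift shift0.
elim: s x => [|y s IH] x; first by exists [::].
move=> /= /and3P[_ /andP[xy _] /IH[w dw ->]].
exists ((y.1 - x.1, y.2 - x.2) :: w); first by rewrite /= share_edge_step.
have yE : shift x (y.1 - x.1, y.2 - x.2) = y by case: (y) => a b; rewrite /shift /= !subrKC.
by rewrite /= yE.
Qed.

Lemma snake_cat (s1 s2 : seq cell) : snake (s1 ++ s2) -> snake s1 && snake s2.
Proof.
elim: s1 => //= x s1 IH /and3P[xs adj /IH/andP[-> ->]]; rewrite !andbT.
move: xs; rewrite mem_cat negb_or => /andP[-> _] /=.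
by case: s1 adj {IH} => //= y s1; rewrite has_cat negb_or => /and3P[-> -> _].
Qed.

Lemma window_fits (m : nat) (s : seq cell) : (2 < size s)%N -> (size s <= 5)%N ->
  (m <= 2)%N -> (m < size s)%N -> (size s = 5 -> m = 2)%N -> (size s = 4 -> 0 < m)%N ->
  snake s -> fits s m (profile s (nth origin s m)).
Proof.
case: s => // x s size3 size5 m2 ms m5 m4 sn; have [w dw sE] := snake_walk x s sn.
have ws : size (x :: s) = (size w).+1 by rewrite sE size_map /= size_scanl.
rewrite ws in size3 size5 ms m5 m4.
have ww := mem_words w dw; have sn0 := sn; rewrite sE snake_shift in sn0.
suff: fits_window m (walk origin w).
  rewrite /fits_window sn0 /= /fits sE (nth_map origin); last by rewrite /walk /= size_scanl.
  by rewrite profile_shift !turn_shift size_map.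
have /and3P[/allP all2 /allP all3 /allP all4] := windows_fit.
have : size w \in [:: 2; 3; 4]%N by rewrite !inE; lia.
rewrite !inE => /or3P[] /eqP sw; rewrite sw in ww.
- have /and3P[f0 f1 f2] := all2 _ ww; by case: m m2 {ms m5 m4} => [|[|[|]]].
- have /andP[f1 f2] := all3 _ ww; rewrite sw in m4.
  by case: m m2 m4 {ms m5} => [_ /(_ erefl)|[|[|]]].
- by rewrite m5 ?sw // all4.
Qed.

Lemma side_corners (c : cell) (e : edge) :
  e \in sides c -> (src e \in corners c) && (tgt e \in corners c).
Proof. by rewrite !inE => /or4P[] /eqP ->; rewrite /src /tgt /= ?eqxx ?orbT. Qed.

Section Profiles.

Variable C : seq cell.
Hypothesis C_snake : snake C.
Hypothesis C_size : (2 < size C)%N.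
Hypothesis C_near : forall (i j : nat) (v : vertex), (i < size C)%N -> (j < size C)%N ->
  v \in corners (nth origin C i) -> v \in corners (nth origin C j) -> (i <= j + 2)%N.

(** Only the squares from i - 2 to i + 2 touch square i, and these contain the
    neighbours of its two neighbours, so they also decide which squares next to i
    are turns. *)
Lemma profile_fits (i : nat) : (i < size C)%N -> fits C i (profile C (nth origin C i)).
Proof.
move=> iC; pose s := drop (i - 2) (take (i + 3) C); pose m := (i - (i - 2))%N.
have CE : C = take (i - 2) C ++ s ++ drop (i + 3) C.
  rewrite catA -{1}(cat_take_drop (i + 3) C); congr (_ ++ _).
  rewrite -{1}(cat_take_drop (i - 2) (take (i + 3) C)) -take_min.
  by congr (take _ _ ++ _); lia.
have sS : size s = (minn (i + 3) (size C) - (i - 2))%N by rewrite size_drop size_take_min.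
have s_nth k : (k < size s)%N -> nth origin s k = nth origin C (i - 2 + k).
  by rewrite sS => ks; rewrite nth_drop nth_take //; lia.
have im : (i = i - 2 + m)%N by rewrite /m; lia.
have ms : (m < size s)%N by rewrite sS /m; lia.
(* The window starts at the beginning of the chain or two squares before [i]; in
   the latter case it does not tell whether its first square is a turn, whence
   [0 < k]. *)
have turnE k : (i - 2 + k < i + 2)%N -> (i <= i - 2 + k + 1)%N ->
    turn s k = (0 < k)%N && turn C (i - 2 + k).
  move=> km mk; rewrite /turn sS.
  case: (ltnP 0 k) => //= k0; have -> : (0 < i - 2 + k)%N by lia.
  case: (ltnP (i - 2 + k).+1 (size C)) => kC; last first.
    by have -> : (k.+1 < minn (i + 3) (size C) - (i - 2))%N = false by lia.
  have -> : (k.+1 < minn (i + 3) (size C) - (i - 2))%N by lia.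
  by rewrite !s_nth ?sS; [congr (~~ collinear (nth _ _ _) (nth _ _ _) (nth _ _ _)); lia|lia..].
have countE (T : Type) (P : T -> pred cell) (x : T) :
    (forall j, (j < size C)%N -> P x (nth origin C j) -> (j <= i + 2)%N && (i <= j + 2)%N) ->
    count (P x) C = count (P x) s.
  move=> near; rewrite {1}CE !count_cat.
  have -> : count (P x) (take (i - 2) C) = 0%N.
    apply/eqP; rewrite -leqn0 leqNgt -has_count; apply/negP => /(has_nthP origin)[j].
    rewrite size_take_min => jC; rewrite nth_take; last by lia.
    by move=> /near; lia.
  have -> : count (P x) (drop (i + 3) C) = 0%N.
    apply/eqP; rewrite -leqn0 leqNgt -has_count; apply/negP => /(has_nthP origin)[j].
    by rewrite size_drop => jC; rewrite nth_drop => /near; lia.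
  by rewrite addn0.
have corner_near v : v \in corners (nth origin C i) ->
    count (fun c => v \in corners c) C = count (fun c => v \in corners c) s.
  move=> vi; apply: (countE _ (fun v c => v \in corners c)) => j jC vj.
  by rewrite (C_near _ _ _ jC iC vj vi) (C_near _ _ _ iC jC vi vj).
have profE : profile C (nth origin C i) = profile s (nth origin C i).
  apply/eq_in_map => e es; have /andP[esrc etgt] := side_corners _ _ es.
  rewrite !corner_near //; congr (_, _).
  apply: (countE _ (fun e c => e \in sides c)) => j jC /side_corners/andP[ej _].
  by rewrite (C_near _ _ _ jC iC ej esrc) (C_near _ _ _ iC jC esrc ej).
have := window_fits m s.
rewrite s_nth // -im -profE /fits => fit.
have -> : ((i == 0) || (i.+1 == size C) = (m == 0) || (m.+1 == size s))%N.
  by rewrite sS /m; lia.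
have -> : turn C i = turn s m.
  by rewrite turnE -?im; [rewrite /turn; case: (ltnP 0 i); rewrite /m; lia | lia..].
have -> : turn C i.-1 = turn s m.-1.
  have [i2|i2] := ltnP 1 i; last by rewrite /turn /m; case: (i) i2 => [|[]].
  by rewrite turnE; [have -> : (i - 2 + m.-1 = i.-1)%N by rewrite /m; lia | |]; rewrite /m; lia.
have -> : turn C i.+1 = turn s m.+1.
  by rewrite turnE /=; [congr turn | |]; rewrite /m; lia.
apply: fit; rewrite ?sS /m; try lia.
have := C_snake; rewrite CE => /snake_cat/andP[_ /snake_cat/andP[]] //.
Qed.
End Profiles.

(** * Discharging *)

Section Weights.

Variables (R : realType) (f : nat -> nat -> R).
Hypothesis f_sym : forall a b, f a b = f b a.

(** A side is shared equally by the squares that it bounds. *)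
Definition weight (p : seq side_type) : R := \sum_(t <- p) f t.2.1 t.2.2 / t.1%:R.

(** The weight of a square of the straight chain. *)
Definition base_weight (terminal_square : bool) : R :=
  if terminal_square then f 2 2 + 2 * f 2 3 + f 3 3 / 2 else 3 * f 3 3.

(** Half the excess of a turn whose neighbours are straight. Passing this amount to
    each neighbour empties such a turn. *)
Definition transfer : R := f 2 3 + f 3 4 / 2 - 3 / 2 * f 3 3.

(** What remains at a square after each turn has given [transfer] to both of its
    neighbours. *)
Definition charge (t k l r : bool) (p : seq side_type) : R :=
  weight p - base_weight t - transfer * (2 * k%:R - l%:R - r%:R).

Lemma weight_profiles (t k l r : bool) (p : seq side_type) :
  has (perm_eq p) (profiles t k l r) -> exists2 q, q \in profiles t k l r & weight p = weight q.
Proof. by case/hasP => q qp pq; exists q => //; apply: perm_big. Qed.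

Lemma charge_eq0 (t k : bool) (p : seq side_type) :
  has (perm_eq p) (profiles t k false false) -> charge t k false false p = 0.
Proof.
rewrite /charge => /weight_profiles[q qp ->]; rewrite /transfer /base_weight; move: qp.
by case: t; case: k; rewrite ?in_nil // !inE => /eqP ->; rewrite /weight !big_cons big_nil /=; lra.
Qed.

(** The charge is Theta1 / 2 + Theta2 for a terminal square, (Theta1 + Theta3) / 2
    or Theta1 + Theta3 for a turn, Theta1 / 2 for a straight square with one turning
    neighbour, and Theta1 or Theta1 + Theta4 between two turns. *)
Lemma charge_gt0 (t k l r : bool) (p : seq side_type) :
  0 < Theta1 f -> 0 < Theta1 f + 2 * Theta2 f ->
  0 < Theta1 f + 2 * Theta3 f -> 0 < Theta1 f + 2 * Theta4 f ->
  has (perm_eq p) (profiles t k l r) -> l || r -> 0 < charge t k l r p.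
Proof.
rewrite /Theta1 /Theta2 /Theta3 /Theta4 /charge => T1 T2 T3 T4 /weight_profiles[q qp ->].
rewrite /transfer /base_weight; move: qp.
by case: t; case: k; case: l; case: r; rewrite ?in_nil // !inE; (try case/orP) => /eqP -> // _;
  rewrite /weight !big_cons big_nil /=; lra.
Qed.

Variables (G : plane_graph) (C : seq cell).
Hypothesis G_sides : forall e, (e \in G) = has (fun c => e \in sides c) C.
Hypothesis G_deg : forall v, v \in verts G -> deg G v = (count (fun c => v \in corners c) C).+1.

Lemma uniq_sides (c : cell) : uniq (sides c).
Proof. by case: c => x y; rewrite /= !inE !xpair_eqE /=; lia. Qed.

Lemma TI_weight : TI f G = \sum_(c <- C) weight (profile C c).
Proof.
pose F (e : edge) : R := f (deg G (src e)) (deg G (tgt e)).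
pose M (e : edge) := count (fun c => e \in sides c) C.
have step e : e \in G -> F e = \sum_(c <- C | e \in sides c) F e / (M e)%:R.
  rewrite G_sides has_count -/(M e) => M0.
  by rewrite big_const_seq iter_addr_0 -/(M e) -[RHS]mulr_natr divfK // pnatr_eq0 -lt0n.
rewrite /TI (eq_big_seq _ step) (exchange_big_dep predT) //=; apply: eq_big_seq => c cC.
rewrite -big_filter /weight /profile big_map (perm_big (sides c)); last first.
  apply: uniq_perm; rewrite ?uniq_sides ?filter_uniq ?fset_uniq // => e.
  rewrite mem_filter; case ec: (e \in sides c) => //=.
  by rewrite G_sides; apply/hasP; exists c.
apply: eq_big_seq => e ec /=.
have eG : e \in G by rewrite G_sides; apply/hasP; exists c.
rewrite /F !G_deg; first last.
- by apply: incident_verts eG _; rewrite /incident eqxx.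
- by apply: incident_verts eG _; rewrite /incident eqxx orbT.
by rewrite -/(M e) /minn /maxn; case: ifP => // _; rewrite f_sym.
Qed.

Hypothesis C_snake : snake C.
Hypothesis C_size : (2 < size C)%N.
Hypothesis C_near : forall (i j : nat) (v : vertex), (i < size C)%N -> (j < size C)%N ->
  v \in corners (nth origin C i) -> v \in corners (nth origin C j) -> (i <= j + 2)%N.

Definition square_charge (i : nat) : R :=
  charge ((i == 0) || (i.+1 == size C))%N (turn C i) (turn C i.-1) (turn C i.+1)
    (profile C (nth origin C i)).

Definition linear_TI (n : nat) : R := \sum_(0 <= i < n) base_weight ((i == 0) || (i.+1 == n))%N.

(** Terminal squares are never turns, so the transfers cancel along the chain. *)
Lemma TI_charge : TI f G = linear_TI (size C) + \sum_(0 <= i < size C) square_charge i.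
Proof.
have telescope : \sum_(0 <= i < size C)
    (2 * (turn C i)%:R - (turn C i.-1)%:R - (turn C i.+1)%:R) = 0 :> R.
  rewrite !big_split /= !sumrN -mulr_sumr.
  have [n sC] : exists n, size C = n.+1 by exists (size C).-1; rewrite prednK // (ltn_trans _ C_size).
  rewrite sC.
  have -> : \sum_(0 <= i < n.+1) (turn C i.-1)%:R = \sum_(0 <= i < n.+1) (turn C i)%:R :> R.
    rewrite big_nat_recl // big_nat_recr //= addrC; congr (_ + _).
    by rewrite /turn sC ltnn andbF.
  have -> : \sum_(0 <= i < n.+1) (turn C i.+1)%:R = \sum_(0 <= i < n.+1) (turn C i)%:R :> R.
    rewrite big_nat_recr // [RHS]big_nat_recl //= addrC; congr (_ + _).
    by rewrite /turn sC [(n.+2 < _)%N]ltnNge leqnSn.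
  by ring.
rewrite TI_weight (big_nth origin) -[RHS]addr0.
transitivity (linear_TI (size C) + \sum_(0 <= i < size C) square_charge i + transfer *
    \sum_(0 <= i < size C) (2 * (turn C i)%:R - (turn C i.-1)%:R - (turn C i.+1)%:R)).
  rewrite mulr_sumr /linear_TI -!big_split /=; apply: eq_bigr => i _.
  rewrite /square_charge /charge; ring.
by rewrite telescope mulr0.
Qed.

Lemma TI_no_turn : (forall j, ~~ turn C j) -> TI f G = linear_TI (size C).
Proof.
move=> noturn; rewrite TI_charge big1_seq ?addr0 // => i.
rewrite mem_index_iota => /= iC; have := profile_fits C C_snake C_size C_near i iC.
by rewrite /fits /square_charge !(negbTE (noturn _)); apply: charge_eq0.
Qed.

(** The square after a turn carries a positive charge. *)
Lemma TI_turn (j : nat) :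
  0 < Theta1 f -> 0 < Theta1 f + 2 * Theta2 f ->
  0 < Theta1 f + 2 * Theta3 f -> 0 < Theta1 f + 2 * Theta4 f ->
  turn C j -> linear_TI (size C) < TI f G.
Proof.
move=> T1 T2 T3 T4 turnj; rewrite TI_charge ltrDl big_mkord.
have fit i : (i < size C)%N -> _ := profile_fits C C_snake C_size C_near i.
have gt0 i : (i < size C)%N -> turn C i.-1 || turn C i.+1 -> 0 < square_charge i.
  by move/fit; apply: charge_gt0.
have ge0 (i : 'I_(size C)) : 0 <= square_charge i.
  have := fit i (ltn_ord i); have := gt0 i (ltn_ord i); rewrite /fits /square_charge.
  by case: (turn C i.-1); case: (turn C i.+1); try move/(_ isT)/ltW; try move=> _ /charge_eq0 ->.
have /and3P[_ jC _] := turnj.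
by rewrite (bigD1 (Ordinal jC)) //= ltr_pwDl ?sumr_ge0 // gt0 //= turnj.
Qed.

End Weights.

Section Degrees.

Variables (G : plane_graph) (C : seq cell).
Hypothesis C_snake : snake C.
Hypothesis C_size : (2 < size C)%N.
Hypothesis C_near : forall (i j : nat) (v : vertex), (i < size C)%N -> (j < size C)%N ->
  v \in corners (nth origin C i) -> v \in corners (nth origin C j) -> (i <= j + 2)%N.

Lemma profiles_turn (t l r : bool) (p : seq side_type) :
  has (perm_eq p) (profiles t true l r) ->
  has (fun u => u.2.1 == 2)%N p && has (fun u => u.2.2 == 4)%N p.
Proof.
by case/hasP => q qp /perm_has eqp; rewrite !eqp; move: qp;
   case: t; case: l; case: r; rewrite ?in_nil // !inE => /eqP ->.
Qed.

Lemma profiles_straight (t : bool) (p : seq side_type) :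
  has (perm_eq p) (profiles t false false false) -> all (fun u => u.2.2 <= 3)%N p.
Proof.
by case/hasP => q qp /perm_all ->; move: qp; case: t; rewrite !inE => /eqP ->.
Qed.

Hypothesis G_deg : forall c v, c \in C -> v \in corners c ->
  deg G v = (count (fun c => v \in corners c) C).+1.

Lemma has_profile (c : cell) (a : pred side_type) : c \in C -> has a (profile C c) ->
  exists2 e, e \in sides c & exists m,
    a (m, (minn (deg G (src e)) (deg G (tgt e)), maxn (deg G (src e)) (deg G (tgt e)))).
Proof.
move=> cC /hasP[_ /mapP[e ec ->] /=]; have /andP[es et] := side_corners _ _ ec.
by rewrite -!(G_deg c) // => ae; exists e => //; eexists; exact: ae.
Qed.

(** A turn has a free outer corner, of degree 2, and an inner corner where three
    squares meet. The first makes it a kink; the second lets an abstract isomorphism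
    detect it. *)
Lemma turn_degrees (j : nat) : turn C j ->
  (exists2 v, v \in corners (nth origin C j) & deg G v = 2%N) /\
  (exists2 v, v \in corners (nth origin C j) & deg G v = 4%N).
Proof.
move=> tj; have /and3P[_ /ltnW jC _] := tj; have cC := mem_nth origin jC.
have := profile_fits C C_snake C_size C_near j jC; rewrite /fits tj.
case/profiles_turn/andP => /(has_profile _ _ cC)[e ec [m e2]] /(has_profile _ _ cC)[g gc [k g4]].
have [/andP[es et] /andP[gs gt]] := (side_corners _ _ ec, side_corners _ _ gc).
split.
- move: e2; rewrite /= /minn; case: ifP => _ /eqP; [by exists (src e) | by exists (tgt e)].
- move: g4; rewrite /= /maxn; case: ifP => _ /eqP; [by exists (tgt g) | by exists (src g)].
Qed.

Lemma corner_side (c : cell) (v : vertex) : v \in corners c ->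
  exists2 e, e \in sides c & incident e v.
Proof.
rewrite !in_cons in_nil orbF => /or4P[] /eqP ->.
- by exists (c, false); rewrite ?inE ?eqxx //; apply/orP; left.
- by exists (c, false); rewrite ?inE ?eqxx //; apply/orP; right.
- by exists (c, true); rewrite ?inE ?eqxx ?orbT //; apply/orP; right.
- by exists ((c.1, c.2 + 1), false); rewrite ?inE ?eqxx ?orbT //; apply/orP; right.
Qed.

Lemma straight_degrees (c : cell) (v : vertex) : (forall j, ~~ turn C j) ->
  c \in C -> v \in corners c -> (deg G v <= 3)%N.
Proof.
move=> noturn cC vc; have [j jC cj] := nthP origin cC.
have := profile_fits C C_snake C_size C_near j jC; rewrite cj /fits !(negbTE (noturn _)).
move/profiles_straight/allP => le3; have [e ec ev] := corner_side _ _ vc.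
have /andP[es et] := side_corners _ _ ec.
have := le3 _ (map_f _ ec); rewrite /= -!(G_deg c) // geq_max => /andP[s3 t3].
by case/orP: ev => /eqP <-.
Qed.

End Degrees.

(** * Straight chains and isomorphisms *)

Definition cell_adj (c : cell) (u w : vertex) : bool := has (fun e => joins e u w) (sides c).

Lemma adj_cells (G : plane_graph) (C : seq cell) :
  (forall e, (e \in G) = has (fun c => e \in sides c) C) ->
  forall u w, adj G u w = has (fun c => cell_adj c u w) C.
Proof.
move=> GC u w; apply/hasP/hasP => [[e]|[c cC /hasP[e ec euw]]].
  by rewrite GC => /hasP[c cC ec] euw; exists c => //; apply/hasP; exists e.
by exists e; rewrite // GC; apply/hasP; exists c.
Qed.

Definition in_box (c : cell) (u : vertex) : bool :=
  (c.1 <= u.1 <= c.1 + 1) && (c.2 <= u.2 <= c.2 + 1).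

Definition taxicab (u w : vertex) : int := `|u.1 - w.1| + `|u.2 - w.2|.

Lemma corners_box (c : cell) (u : vertex) : (u \in corners c) = in_box c u.
Proof.
case: c u => [x y] [a b]; rewrite /in_box !inE !xpair_eqE /=; lia.
Qed.

Lemma cell_adjE (c : cell) (u w : vertex) : cell_adj c u w =
  [&& in_box c u, in_box c w & taxicab u w == 1].
Proof.
apply/idP/idP => [/hasP[e /side_corners/andP[es et]]|].
  have e1 : taxicab (src e) (tgt e) == 1 by case: (e) => [[x y] []]; rewrite /taxicab /src /tgt /=; lia.
  have e2 : taxicab (tgt e) (src e) == 1 by case: (e) => [[x y] []]; rewrite /taxicab /src /tgt /=; lia.
  by rewrite /joins => /orP[] /andP[/eqP <- /eqP <-]; rewrite -!corners_box es et ?e1 ?e2.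
rewrite -!corners_box !in_cons !in_nil !orbF /taxicab => /and3P[].
by move=> /or4P[] /eqP -> /or4P[] /eqP ->; rewrite /cell_adj /= !joinsE /=; lia.
Qed.

Definition grid_iso (G H : plane_graph) : Prop :=
  exists s t : vertex -> vertex, [/\ cancel s t, cancel t s
    & forall u w, adj H (s u) (s w) = adj G u w].

(** The symmetries of the grid carry the horizontal strip starting at the origin to
    the strip starting at [x] in any of the four directions. A cell is named by its
    lower left corner, hence the shift by 1 in the two reversed directions. *)
Lemma strip_embedding (x d : int * int) : d \in dirs ->
  exists s t : vertex -> vertex, [/\ cancel s t, cancel t s
    & forall (k : nat) u w,
      cell_adj (x.1 + k%:Z * d.1, x.2 + k%:Z * d.2) (s u) (s w) = cell_adj (k%:Z, 0) u w].
Proof.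
rewrite !inE => /or4P[] /eqP ->.
- exists (fun u => (x.1 + u.1, x.2 + u.2)), (fun u => (u.1 - x.1, u.2 - x.2)).
  by split=> [[u1 u2]|[u1 u2]|k u w]; [congr (_, _) => /=; lia | congr (_, _) => /=; lia |
    rewrite !cell_adjE; congr [&& _, _ & _]; rewrite /in_box /taxicab /=; lia].
- exists (fun u => (x.1 + u.2, x.2 + u.1)), (fun u => (u.2 - x.2, u.1 - x.1)).
  by split=> [[u1 u2]|[u1 u2]|k u w]; [congr (_, _) => /=; lia | congr (_, _) => /=; lia |
    rewrite !cell_adjE; congr [&& _, _ & _]; rewrite /in_box /taxicab /=; lia].
- exists (fun u => (x.1 + 1 - u.1, x.2 + u.2)), (fun u => (x.1 + 1 - u.1, u.2 - x.2)).
  by split=> [[u1 u2]|[u1 u2]|k u w]; [congr (_, _) => /=; lia | congr (_, _) => /=; lia |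
    rewrite !cell_adjE; congr [&& _, _ & _]; rewrite /in_box /taxicab /=; lia].
- exists (fun u => (x.1 + u.2, x.2 + 1 - u.1)), (fun u => (x.2 + 1 - u.2, u.1 - x.1)).
  by split=> [[u1 u2]|[u1 u2]|k u w]; [congr (_, _) => /=; lia | congr (_, _) => /=; lia |
    rewrite !cell_adjE; congr [&& _, _ & _]; rewrite /in_box /taxicab /=; lia].
Qed.

Lemma adj_sym (G : plane_graph) (u w : vertex) : adj G u w = adj G w u.
Proof. by apply: eq_has => e; apply: joins_sym. Qed.

Lemma verts_adj (G : plane_graph) (u : vertex) : u \in verts G <-> exists w, adj G u w.
Proof.
split=> [|[w /hasP[e eG euw]]]; last by apply: incident_verts eG _; apply: (joins_incident e u w).
have wit e x w : e \in G -> joins e x w -> exists w, adj G x w.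
  by move=> eG exw; exists w; apply/hasP; exists e.
rewrite /verts in_fsetU => /orP[] /imfsetP[e /= eG ->];
  [apply: (wit e _ (tgt e)) | apply: (wit e _ (src e))]; by rewrite // /joins !eqxx ?orbT.
Qed.

Lemma grid_iso_sym (G H : plane_graph) : grid_iso G H -> grid_iso H G.
Proof. by move=> [s [t [st ts sE]]]; exists t, s; split=> // u w; rewrite -sE !ts. Qed.

Lemma grid_iso_trans (G H K : plane_graph) : grid_iso G H -> grid_iso H K -> grid_iso G K.
Proof.
move=> [s [t [st ts sE]]] [s1 [t1 [st1 ts1 sE1]]].
by exists (s1 \o s), (t \o t1); split=> [||u w]; [exact: can_comp|exact: can_comp|rewrite /= sE1].
Qed.

Lemma grid_iso_isomorphic (G H : plane_graph) : grid_iso G H -> isomorphic G H.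
Proof.
move=> [s [t [st ts sE]]].
have sG (u : verts G) : s (val u) \in verts H.
  by have /verts_adj[w uw] := valP u; apply/verts_adj; exists (s w); rewrite sE.
have tH (u : verts H) : t (val u) \in verts G.
  by have /verts_adj[w uw] := valP u; apply/verts_adj; exists (t w); rewrite -sE !ts.
exists (fun u => [` sG u]%fset); last by move=> u w; rewrite /= sE.
exists (fun u => [` tH u]%fset) => u; apply: val_inj => /=; [exact: st | exact: ts].
Qed.

Lemma no_turn_line (C : seq cell) : snake C -> (1 < size C)%N -> (forall j, ~~ turn C j) ->
  exists2 d, d \in dirs & forall k, (k < size C)%N ->
    nth origin C k = ((nth origin C 0).1 + k%:Z * d.1, (nth origin C 0).2 + k%:Z * d.2).
Proof.
move=> snC C1 noturn.
have sh : share_edge (nth origin C 0) (nth origin C 1).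
  by case: C snC C1 {noturn} => [|x [|y s]] //= /and3P[_ /andP[]].
exists (shift (nth origin C 1) (- (nth origin C 0).1, - (nth origin C 0).2)).
  by have := share_edge_step _ _ sh.
move=> k; elim/ltn_ind: k => -[_ _|[_ _|k IH kC]]; rewrite /shift /=.
- by case: nth => a b; congr (_, _) => /=; lia.
- by case: (nth _ _ 1) => a b; congr (_, _) => /=; lia.
have := noturn k.+1; rewrite /turn kC /= negbK /collinear.
rewrite (IH k) ?(IH k.+1) //; [|exact: ltnW..|exact/ltnW/ltnW].
case: (nth _ _ k.+2) => a b; rewrite /shift /= => /andP[/eqP E1 /eqP E2].
congr (_, _) => /=; lia.
Qed.

(** Both graphs are compared with the horizontal strip that starts at the origin. *)
Lemma no_turn_grid_iso (G H : plane_graph) (C D : seq cell) :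
  (forall e, (e \in G) = has (fun c => e \in sides c) C) ->
  (forall e, (e \in H) = has (fun c => e \in sides c) D) ->
  snake C -> snake D -> (1 < size C)%N -> size C = size D ->
  (forall j, ~~ turn C j) -> (forall j, ~~ turn D j) -> grid_iso G H.
Proof.
move=> GC HD snC snD C1 CD noC noD.
pose S : plane_graph := [fset e in flatten [seq sides ((k%:Z, 0) : cell) | k <- iota 0 (size C)]]%fset.
have SE e : (e \in S) = has (fun c => e \in sides c) [seq ((k%:Z, 0) : cell) | k <- iota 0 (size C)].
  rewrite inE has_map; apply/flatten_mapP/hasP => [[k ks ek]|[k ks ek]]; by exists k.
have key K (E : seq cell) : (forall e, (e \in K) = has (fun c => e \in sides c) E) ->
    snake E -> size E = size C -> (forall j, ~~ turn E j) -> grid_iso S K.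
  move=> KE snE EC noE; rewrite -EC in C1.
  have [d dd line] := no_turn_line E snE C1 noE.
  have [s [t [st ts sE]]] := strip_embedding (nth origin E 0) d dd.
  exists s, t; split=> // u w; rewrite (adj_cells _ _ KE) (adj_cells _ _ SE) has_map -EC.
  rewrite -{1}[E](mkseq_nth origin) /mkseq has_map; apply: eq_in_has => k.
  by rewrite mem_iota => /= kE; rewrite line // sE.
apply: grid_iso_trans (key H D HD snD (esym CD) noD).
by apply: grid_iso_sym; apply: key GC snC _ noC.
Qed.

Definition neighbours (v : vertex) : seq vertex :=
  [:: (v.1 + 1, v.2); (v.1, v.2 + 1); (v.1 - 1, v.2); (v.1, v.2 - 1)].

Lemma uniq_neighbours (v : vertex) : uniq (neighbours v).
Proof. by case: v => a b; rewrite /= !inE !xpair_eqE /=; lia. Qed.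

(** The degree counts edges of the grid; this expresses it through adjacency, which
    isomorphisms respect. *)
Lemma deg_neighbours (G : plane_graph) (v : vertex) :
  deg G v = count (adj G v) (neighbours v).
Proof.
have adjE e w : joins e v w -> adj G v w = (e \in G).
  move=> evw; apply/hasP/idP => [[g gG gvw]|eG]; last by exists e.
  by rewrite (joins_inj _ _ _ _ evw gvw).
rewrite deg_star; case: v adjE => x y adjE.
rewrite /= (adjE ((x, y), false) (x + 1, y)) ?(adjE ((x, y), true) (x, y + 1))
  ?(adjE ((x - 1, y), false) (x - 1, y)) ?(adjE ((x, y - 1), true) (x, y - 1)) //;
  by rewrite joinsE /= ?subrK ?eqxx ?orbT.
Qed.

Lemma adj_neighbours (G : plane_graph) (v w : vertex) : adj G v w -> w \in neighbours v.
Proof.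
case/hasP => e _; rewrite -/(joins e v w) joinsE !inE; case: v w e => [a b] [c d] [[x y] []];
 rewrite !xpair_eqE /=; lia.
Qed.

(** The images of four neighbours are four grid neighbours of the image. *)
Lemma isomorphic_deg4 (G H : plane_graph) (v : vertex) : isomorphic G H ->
  v \in verts G -> deg G v = 4%N -> exists2 w, w \in verts H & deg H w = 4%N.
Proof.
move=> [phi [psi phiK _] phiE] vG; rewrite deg_neighbours => d4.
have allv : all (adj G v) (neighbours v) by rewrite all_count d4.
pose v1 := phi [` vG]%fset.
exists (val v1); first exact: valP.
pose h w : vertex := if insub w is Some u then val (phi u) else w.
have hE w : adj G v w -> exists2 u : verts G, val u = w & h w = val (phi u).
  move=> vw; have wG : w \in verts G.
    by apply/verts_adj; exists v; rewrite adj_sym.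
  by exists [` wG]%fset; rewrite // /h insubT.
rewrite deg_neighbours; apply/eqP; rewrite eqn_leq.
apply/andP; split; first exact: (count_size _ (neighbours _)).
rewrite -[4%N]/(size (neighbours v)) -(size_map h) -size_filter.
apply: uniq_leq_size => [|z /mapP[w wv ->]].
  rewrite map_inj_in_uniq ?uniq_neighbours // => w z wv zv.
  have [u <- ->] := hE w (allP allv w wv); have [x <- ->] := hE z (allP allv z zv).
  by move/val_inj/(can_inj phiK) => ->.
have vw := allP allv w wv; have [u uw ->] := hE w vw.
have v1u : adj H (val v1) (val (phi u)) by rewrite phiE uw.
by rewrite mem_filter v1u (adj_neighbours _ _ _ v1u).
Qed.

(** * From plane chains to lists of cells *)

(** What the rest of the argument uses about a chain, with its squares listed in
    order. *)
Record chain_code (n : nat) (G : plane_graph) (C : seq cell) : Prop := ChainCode {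
  code_size : size C = n;
  code_snake : snake C;
  code_sides : forall e, (e \in G) = has (fun c => e \in sides c) C;
  code_deg : forall v, v \in verts G -> deg G v = (count (fun c => v \in corners c) C).+1;
  code_verts : forall c v, c \in C -> v \in corners c -> v \in verts G;
  code_near : forall (i j : nat) (v : vertex), (i < size C)%N -> (j < size C)%N ->
    v \in corners (nth origin C i) -> v \in corners (nth origin C j) -> (i <= j + 2)%N;
  code_nonterminal : forall j, (0 < j)%N -> (j.+1 < size C)%N -> nonterminal G (nth origin C j)
}.

Lemma snake_nth (s : seq cell) : uniq s ->
  (forall i j, (i < j < size s)%N ->
     share_edge (nth origin s i) (nth origin s j) = (j == i.+1)) -> snake s.
Proof.
elim: s => //= x s IH /andP[xs us] adj.
have adj_tail i j : (i < j < size s)%N ->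
    share_edge (nth origin s i) (nth origin s j) = (j == i.+1).
  by move=> ij; apply: (adj i.+1 j.+1).
rewrite xs IH // andbT; case: s adj {adj_tail IH us xs} => // y s adj.
rewrite (adj 0 1)%N //=; apply/negP => /(has_nthP origin)[k ks].
by rewrite (adj 0%N k.+2).
Qed.

Lemma chain_has_code (n : nat) (G : plane_graph) : polyomino_chain n G ->
  exists C, chain_code n G C.
Proof.
move=> [Gsys _ [C [uniqC CsqG C_adj]]].
have CG c : reflect (squares G c) (c \in C) by rewrite -CsqG; apply: idP.
have sC : size C = n by rewrite size_tuple.
have adj i j : (i < n)%N -> (j < n)%N ->
    share_edge (nth origin C i) (nth origin C j) = (j == i.+1) || (i == j.+1).
  by move=> iC jC; have := C_adj (Ordinal iC) (Ordinal jC); rewrite !(tnth_nth origin).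
exists C; split=> //.
- by apply: snake_nth => // i j; rewrite sC => ij; rewrite adj; lia.
- move=> e; apply/idP/hasP => [eG|[c cC]].
    have /orP[eC|eC] := edge_in_square _ _ _ Gsys CG e eG; [exists e.1 | exists (other_cell e)];
    by rewrite // mem_sides eqxx ?orbT.
  exact: chain_sides _ _ _ Gsys CG _ _ cC.
- exact: deg_count _ _ _ Gsys uniqC CG C_adj.
- exact: corner_verts _ _ _ Gsys CG.
- move=> i j v; rewrite sC => iC jC.
  have := share_corner_near _ _ _ Gsys uniqC CG C_adj (Ordinal iC) (Ordinal jC) v.
  by rewrite !(tnth_nth origin).
- move=> j j0; rewrite sC => jn.
  have jC : nth origin C j \in C by rewrite mem_nth // sC ltnW.
  split; first exact/CG.
  rewrite (_ : adj_squares G _ = [set` [fset nth origin C j.-1; nth origin C j.+1]%fset])%classic.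
    by apply/card_eq_fsetP; rewrite cardfs2 nth_uniq ?sC //; lia.
  apply/seteqP; split=> c /=; rewrite !inE.
    move=> [/CG cC]; have [k kn <-] := nthP origin cC; rewrite sC in kn.
    rewrite adj //; last by lia.
    by move=> /orP[] /eqP jk; rewrite jk /= eqxx ?orbT.
  move=> /orP[] /eqP ->; split; try (apply/CG; rewrite mem_nth // sC; lia);
    by rewrite adj; lia.
Qed.

Lemma code_deg_corner (n : nat) (G : plane_graph) (C : seq cell) :
  chain_code n G C -> forall c v, c \in C -> v \in corners c ->
  deg G v = (count (fun c => v \in corners c) C).+1.
Proof. by move=> code c v cC vc; apply: (code_deg _ _ _ code); apply: code_verts code _ _ cC vc. Qed.

Lemma linear_no_turn (n : nat) (G : plane_graph) (C : seq cell) :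
  (2 < n)%N -> linear_chain n G -> chain_code n G C -> forall j, ~~ turn C j.
Proof.
move=> n3 [_ nokink] code j; apply/negP => tj; apply: (nokink (nth origin C j)).
have /and3P[j0 jC _] := tj; split; first exact: code_nonterminal code _ j0 jC.
have [] // := turn_degrees G C (code_snake _ _ _ code) _ (code_near _ _ _ code)
  (code_deg_corner _ _ _ code) j tj.
by rewrite (code_size _ _ _ code).
Qed.

(** A turn creates a vertex of degree 4, which a chain without turns cannot have. *)
Lemma isomorphic_no_turn (n : nat) (G H : plane_graph) (C D : seq cell) :
  (2 < n)%N -> chain_code n G C -> chain_code n H D ->
  isomorphic G H -> (forall j, ~~ turn D j) -> forall j, ~~ turn C j.
Proof.
move=> n3 codeG codeH isoGH noturn j; apply/negP => tj.
have sC : (2 < size C)%N by rewrite (code_size _ _ _ codeG).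
have sD : (2 < size D)%N by rewrite (code_size _ _ _ codeH).
have [_ [v vc v4]] := turn_degrees G C (code_snake _ _ _ codeG) sC (code_near _ _ _ codeG)
  (code_deg_corner _ _ _ codeG) j tj.
have /and3P[_ /ltnW jC _] := tj.
have vG : v \in verts G by apply: code_verts codeG _ _ (mem_nth origin jC) vc.
have [w wH w4] := isomorphic_deg4 _ _ _ isoGH vG v4.
have : has (fun c => w \in corners c) D.
  by rewrite has_count -ltnS -(code_deg _ _ _ codeH) // w4.
move=> /hasP[c cD wc].
have := straight_degrees H D (code_snake _ _ _ codeH) sD (code_near _ _ _ codeH)
  (code_deg_corner _ _ _ codeH) c w noturn cD wc.
by rewrite w4.
Qed.

(** Chains without turns share one value of the index, and every turn makes the index
    strictly larger. *)
Lemma minimum_iff (R : realType) (f : nat -> nat -> R) (f_sym : forall a b, f a b = f b a)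
  (n : nat) (n_ge3 : (3 <= n)%N) (B : plane_graph) (B_chain : polyomino_chain n B)
  (L : plane_graph) (L_linear : linear_chain n L) :
  0 < Theta1 f -> 0 < Theta1 f + 2 * Theta2 f ->
  0 < Theta1 f + 2 * Theta3 f -> 0 < Theta1 f + 2 * Theta4 f ->
  (TI_minimum f n B <-> isomorphic B L).
Proof.
move=> T1 T2 T3 T4.
have straight G C : chain_code n G C -> (forall j, ~~ turn C j) -> TI f G = linear_TI _ f n.
  move=> code noturn; rewrite -(code_size _ _ _ code).
  apply: (TI_no_turn _ f f_sym _ _ (code_sides _ _ _ code) (code_deg _ _ _ code)
    (code_snake _ _ _ code) _ (code_near _ _ _ code) noturn).
  by rewrite (code_size _ _ _ code).
have bent G C j : chain_code n G C -> turn C j -> linear_TI _ f n < TI f G.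
  move=> code tj; rewrite -(code_size _ _ _ code).
  apply: (TI_turn _ f f_sym _ _ (code_sides _ _ _ code) (code_deg _ _ _ code)
    (code_snake _ _ _ code) _ (code_near _ _ _ code) _ T1 T2 T3 T4 tj).
  by rewrite (code_size _ _ _ code).
have [D codeL] := chain_has_code _ _ L_linear.1.
have noD := linear_no_turn _ _ _ n_ge3 L_linear codeL.
have [C codeB] := chain_has_code _ _ B_chain.
split=> [Bmin | /isomorphic_no_turn noturn G G_chain].
  have noC j : ~~ turn C j.
    apply/negP => tj; have := Bmin L L_linear.1.
    by rewrite (straight L D codeL noD) leNgt (bent B C j codeB tj).
  have sC := code_size _ _ _ codeB; have sD := code_size _ _ _ codeL.
  apply: grid_iso_isomorphic; apply: (no_turn_grid_iso _ _ C D (code_sides _ _ _ codeB)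
    (code_sides _ _ _ codeL) (code_snake _ _ _ codeB) (code_snake _ _ _ codeL)) => //.
    by rewrite sC ltnW.
  by rewrite sC sD.
rewrite (straight B C codeB (noturn _ _ _ n_ge3 codeB codeL noD)).
have [E codeG] := chain_has_code _ _ G_chain.
have [[j tj]|noE] := pselect (exists j, turn E j); first exact/ltW/bent/tj.
by rewrite (straight G E codeG) // => j; apply/negP => tj; apply: noE; exists j.
Qed.

(** * Extremality of the linear chain *)

Theorem theorem2p10 (R : realType) (f : nat -> nat -> R)
  (f_sym : forall a b, f a b = f b a) (f_ge0 : forall a b, 0 <= f a b)
  (n : nat) (n_ge3 : (3 <= n)%N)
  (B : plane_graph) (B_chain : polyomino_chain n B)
  (L : plane_graph) (L_linear : linear_chain n L) :
  (0 < Theta1 f -> 0 < Theta1 f + 2 * Theta2 f ->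
   0 < Theta1 f + 2 * Theta3 f -> 0 < Theta1 f + 2 * Theta4 f ->
   (TI_minimum f n B <-> isomorphic B L)) /\
  (Theta1 f < 0 -> Theta1 f + 2 * Theta2 f < 0 ->
   Theta1 f + 2 * Theta3 f < 0 -> Theta1 f + 2 * Theta4 f < 0 ->
   (TI_maximum f n B <-> isomorphic B L)).
Proof.
split; first exact: minimum_iff.
(* Maximising the index of [f] is minimising that of [- f]. *)
move=> T1 T2 T3 T4; pose g a b := - f a b.
have TIg G : TI g G = - TI f G by rewrite /TI sumrN.
rewrite -(minimum_iff R g _ n n_ge3 B B_chain L L_linear).
- by split=> ext G /ext; rewrite !TIg lerN2.
- by move=> a b; rewrite /g f_sym.
all: by move: T1 T2 T3 T4; rewrite /Theta1 /Theta2 /Theta3 /Theta4 /g; lra.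
Qed.
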